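(* Let $(X,\mathcal{A},\mu)$ be a $\sigma$-finite measure space and let $(A_n)_{n\in\mathbb{N}}$ be measurable sets of finite measure with $A_n\subseteq A_{n+1}$ for all $n$ and $X=\bigcup_{n=1}^\infty A_n$. Let $\mathcal{S}$ be the set of all measurable simple functions belonging to $L^1(X)$, and let $S:\mathcal{S}\to L^1(X)$ be a linear map. Then $S$ has a unique extension to a semi-doubly stochastic operator on $L^1(X)$ if and only if $S$ is nonnegative (maps nonnegative functions to nonnegative functions) and for every measurable set $E$ with $\mu(E)<\infty$: $$\int_X S\chi_E\,d\mu=\mu(E)\qquad\text{and}\qquad \lim_{n\to\infty}\int_X \chi_E\, S\chi_{A_n}\,d\mu\le\mu(E).$$
   Context: A Markov operator on $L^1(X)$ is a positive linear operator $T:L^1(X)\to L^1(X)$ with $\int_X Tf\,d\mu=\int_X f\,d\mu$ for all $f\in L^1(X)$. A Markov operator $T$ is semi-doubly stochastic if $\int_X T^*\chi_E\,d\mu\le\mu(E)$ for every $E\in\mathcal{A}$ with $\mu(E)<\infty$, where $T^*:L^\infty(X)\to L^\infty(X)$ is the Banach adjoint. $\chi_E$ denotes the indicator function of $E$. *)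

(* Defs.v *)
From HB Require Import structures.
From mathcomp Require Import all_boot all_order all_algebra.
From mathcomp Require Import all_classical all_reals all_analysis.
Set Implicit Arguments. Unset Strict Implicit. Unset Printing Implicit Defensive.
Import Order.TTheory GRing.Theory Num.Theory.
Local Open Scope classical_set_scope.
Local Open Scope ring_scope.

(* Elements of L^1(X) are represented by integrable real functions, modulo
   mu-a.e. equality. An operator on L^1(X) is represented by a map on
   functions; only its values on integrable functions, up to a.e. equality,
   matter. *)
Section Defs.
Context (d : measure_display) (T : measurableType d) (R : realType)
        (mu : {measure set T -> \bar R}).

Definition L1 (f : T -> R) : Prop := mu.-integrable setT (EFin \o f).

Definition aeeq (f g : T -> R) : Prop := {ae mu, forall x, f x = g x}.

Definition ae_nonneg (f : T -> R) : Prop := {ae mu, forall x, 0 <= f x}.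

Definition Linfty (h : T -> R) : Prop :=
  measurable_fun setT h /\ exists M : R, {ae mu, forall x, `|h x| <= M}.

Definition simple_L1 (f : T -> R) : Prop :=
  [/\ measurable_fun setT f, finite_set (range f) & L1 f].

Definition L1_operator (Op : (T -> R) -> (T -> R)) : Prop :=
  [/\ (forall f, L1 f -> L1 (Op f)),
      (forall f g, L1 f -> L1 g -> aeeq f g -> aeeq (Op f) (Op g)) &
      (forall (a : R) f g, L1 f -> L1 g ->
         aeeq (Op (fun x => a * f x + g x)) (fun x => a * Op f x + Op g x))].

Definition markov_operator (Op : (T -> R) -> (T -> R)) : Prop :=
  [/\ L1_operator Op,
      (forall f, L1 f -> ae_nonneg f -> ae_nonneg (Op f)) &
      (forall f, L1 f ->
         (\int[mu]_x (Op f x)%:E = \int[mu]_x (f x)%:E)%E)].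

(* h represents Op^* g (Banach adjoint, Op^* : L^oo -> L^oo), i.e.
   <h, f> = <g, Op f> for all f in L^1. *)
Definition adjoint_at (Op : (T -> R) -> (T -> R)) (g h : T -> R) : Prop :=
  Linfty h /\
  forall f, L1 f ->
    (\int[mu]_x (h x * f x)%:E = \int[mu]_x (g x * Op f x)%:E)%E.

Definition semi_doubly_stochastic (Op : (T -> R) -> (T -> R)) : Prop :=
  markov_operator Op /\
  forall E, measurable E -> (mu E < +oo)%E ->
    exists h, adjoint_at Op (\1_E) h /\
      (\int[mu]_x (h x)%:E <= mu E)%E.

End Defs.

(* Main.v *)
(* Write [S] for the given map on simple integrable functions. If [S] is
   positive and preserves the integral of indicators, then it preserves the
   integral of every simple function and [|S f| <= S |f|], so [S] is an
   L^1-contraction; simple functions being dense, it has exactly one continuous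
   extension [Op]. The extension is obtained by closing the graph of [S]: over a
   nonnegative [f] the graph is nonempty by monotone convergence of [S s_n] for
   simple [s_n] increasing to [f].

   For the adjoint, [phi f = int_E Op f] is a positive functional with
   [phi f <= int f] for [f >= 0], hence [B |-> phi 1_B] is countably additive on
   sets of finite measure. The bound on [lim int_E S 1_(A n)] says precisely
   that it extends to a finite measure of mass at most [mu E] on the whole
   space, and its Radon-Nikodym density is [Op^* 1_E].

   Conversely, [Op^* 1_E] is nonnegative, and
   [int_E S 1_(A n) = int_(A n) Op^* 1_E] is nondecreasing in [n] and bounded by
   [int Op^* 1_E <= mu E]. *)

Require Import Defs.
From HB Require Import structures.
From mathcomp Require Import all_boot all_order all_algebra.
From mathcomp Require Import all_classical all_reals all_analysis.
From mathcomp Require Import finmap measurable_realfun lra.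
Import Order.TTheory GRing.Theory Num.Theory.
Import numFieldNormedType.Exports HBSimple HBNNSimple.
Local Open Scope classical_set_scope.
Local Open Scope ring_scope.

(** * The L^1 distance, simple integrable functions, and monotone convergence in L^1 *)

Section L1_theory.
Set Implicit Arguments.
Unset Strict Implicit.
Context (d : measure_display) (X : measurableType d) (R : realType)
        (mu : {measure set X -> \bar R}).
Implicit Types (f g : X -> R) (a : R) (B : set X).

Definition dist1 f g : R := \int[mu]_x `|f x - g x|.

Lemma L1_measurable f : L1 mu f -> measurable_fun setT f.
Proof. by move=> /measurable_int/measurable_EFinP. Qed.

Lemma L1_lin a f g : L1 mu f -> L1 mu g -> L1 mu (fun x => a * f x + g x).
Proof.
by move=> If Ig; apply: eq_integrable (integrableD _ (integrableZl _ a If) Ig).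
Qed.

Lemma L1_abs f : L1 mu f -> L1 mu (fun x => `|f x|).
Proof. exact: integrable_norm. Qed.

Lemma L1_sub f g : L1 mu f -> L1 mu g -> L1 mu (fun x => f x - g x).
Proof. by move=> If Ig; apply: eq_integrable (integrableB _ If Ig). Qed.

Lemma L1_add f g : L1 mu f -> L1 mu g -> L1 mu (fun x => f x + g x).
Proof. by move=> If Ig; apply: eq_integrable (integrableD _ If Ig). Qed.

Lemma L1_dist f g : L1 mu f -> L1 mu g -> L1 mu (fun x => `|f x - g x|).
Proof. by move=> If Ig; apply: L1_abs; apply: L1_sub. Qed.

Lemma L1_cst0 : L1 mu (fun=> 0).
Proof. exact: integrable0. Qed.

Lemma L1_le f g : measurable_fun setT f -> (forall x, `|f x| <= `|g x|) ->
  L1 mu g -> L1 mu f.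
Proof.
move=> mf fg; apply: le_integrable => //; first exact/measurable_EFinP.
by move=> x _ /=; rewrite lee_fin.
Qed.

Lemma L1_integralE f : L1 mu f ->
  (\int[mu]_x (f x)%:E)%E = (\int[mu]_x f x)%:E.
Proof. by move=> If; rewrite fineK//; exact: integrable_fin_num. Qed.

Lemma Rintegral_lin a f g : L1 mu f -> L1 mu g ->
  \int[mu]_x (a * f x + g x) = a * \int[mu]_x f x + \int[mu]_x g x.
Proof.
move=> If Ig; rewrite RintegralD//; last first.
  by apply: eq_integrable (integrableZl _ a If).
by rewrite RintegralZl.
Qed.

Lemma Rintegral_ae_eq f g : L1 mu f -> L1 mu g -> aeeq mu f g ->
  \int[mu]_x f x = \int[mu]_x g x.
Proof.
move=> If Ig fg; congr fine; apply: ae_eq_integral => //.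
- exact: measurable_int If.
- exact: measurable_int Ig.
- by apply: filterS fg => x -> _.
Qed.

Lemma Rintegral_ae_ge0 f : L1 mu f -> ae_nonneg mu f -> 0 <= \int[mu]_x f x.
Proof.
move=> If f0; rewrite (@Rintegral_ae_eq _ (fun x => `|f x|))//.
- exact: Rintegral_ge0.
- exact: L1_abs.
- by apply: filterS f0 => x /ger0_norm ->.
Qed.

Lemma Rintegral_ae_le f g : L1 mu f -> L1 mu g ->
  {ae mu, forall x, f x <= g x} -> \int[mu]_x f x <= \int[mu]_x g x.
Proof.
move=> If Ig fg; rewrite -subr_ge0 -RintegralB//.
apply: Rintegral_ae_ge0; first exact: L1_sub.
by apply: filterS fg => x; rewrite subr_ge0.
Qed.

Lemma Rintegral_abs_eq0 f : L1 mu f -> \int[mu]_x `|f x| <= 0 ->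
  {ae mu, forall x, f x = 0}.
Proof.
move=> If f0.
have : (\int[mu]_x `|(f x)%:E| = 0)%E.
  rewrite /= L1_integralE; last exact: L1_abs.
  by congr EFin; apply/eqP; rewrite eq_le f0; apply: Rintegral_ge0.
move/(ae_eq_integral_abs _ measurableT (measurable_int _ If)).
by apply: filterS => x /(_ I) [].
Qed.

Lemma dist1_ge0 f g : 0 <= dist1 f g.
Proof. exact: Rintegral_ge0. Qed.

Lemma dist1C f g : dist1 f g = dist1 g f.
Proof. by apply: eq_Rintegral => x _; rewrite distrC. Qed.

Lemma dist1_triangle f g h : L1 mu f -> L1 mu g -> L1 mu h ->
  dist1 f h <= dist1 f g + dist1 g h.
Proof.
move=> If Ig Ih; rewrite -RintegralD//; [|exact: L1_dist..].
apply: le_Rintegral => //; first exact: L1_dist.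
  by apply: L1_add; apply: L1_dist.
by move=> x _; exact: ler_distD.
Qed.

Lemma dist1_lin a f g f' g' : L1 mu f -> L1 mu g -> L1 mu f' -> L1 mu g' ->
  dist1 (fun x => a * f x + g x) (fun x => a * f' x + g' x) <=
  `|a| * dist1 f f' + dist1 g g'.
Proof.
move=> If Ig If' Ig'; rewrite -Rintegral_lin; [|exact: L1_dist..].
apply: le_Rintegral => //.
- by apply: L1_dist; apply: L1_lin.
- by apply: L1_lin; apply: L1_dist.
- move=> x _; rewrite -normrM mulrBr.
  rewrite (_ : _ - _ = (a * f x - a * f' x) + (g x - g' x)) ?ler_normD//.
  by lra.
Qed.

Lemma dist1_integral f g : L1 mu f -> L1 mu g ->
  `|\int[mu]_x f x - \int[mu]_x g x| <= dist1 f g.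
Proof.
by move=> If Ig; rewrite -RintegralB//; apply: le_normr_Rintegral => //;
  exact: L1_sub.
Qed.

Lemma dist1_ae_eq f g : L1 mu f -> L1 mu g ->
  (forall e, 0 < e -> dist1 f g <= e) -> aeeq mu f g.
Proof.
move=> If Ig fg.
have /(Rintegral_abs_eq0 (L1_sub If Ig)) : dist1 f g <= 0.
  by apply/ler_addgt0Pr => e e0; rewrite add0r; exact: fg.
by apply: filterS => x /eqP; rewrite subr_eq0 => /eqP.
Qed.

Lemma ae_eq_dist1 f g : L1 mu f -> L1 mu g -> aeeq mu f g -> dist1 f g = 0.
Proof.
move=> If Ig fg; rewrite /dist1 (@Rintegral_ae_eq _ (fun=> 0)).
- by rewrite Rintegral_cst// mul0r.
- exact: L1_dist.
- exact: L1_cst0.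
- by apply: filterS fg => x ->; rewrite subrr normr0.
Qed.

Lemma L1_indic B : measurable B -> (mu B < +oo)%E -> L1 mu \1_B.
Proof.
move=> mB Boo; apply/integrableP; split; first exact/measurable_EFinP.
under eq_integral do rewrite /= ger0_norm//.
by rewrite integral_indic// setIT.
Qed.

Lemma Rintegral_indic B : measurable B -> \int[mu]_x (\1_B x) = fine (mu B) :> R.
Proof. by move=> mB; rewrite /Rintegral integral_indic// setIT. Qed.

Lemma simple_L1_L1 f : simple_L1 mu f -> L1 mu f.
Proof. by case. Qed.

Lemma simple_L1_lin a f g : simple_L1 mu f -> simple_L1 mu g ->
  simple_L1 mu (fun x => a * f x + g x).
Proof.
move=> [mf ff If] [mg fg Ig]; split; last exact: L1_lin.
  by apply: measurable_funD => //; exact: measurable_funM.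
apply: (@sub_finite_set _ _ ((fun p => a * p.1 + p.2) @` (range f `*` range g))).
  by move=> _ [x _ <-]; exists (f x, g x) => //=; split; exists x.
by apply: finite_image; exact: finite_setX.
Qed.

Lemma simple_L1_abs f : simple_L1 mu f -> simple_L1 mu (fun x => `|f x|).
Proof.
move=> [mf ff If]; split; last exact: L1_abs.
  exact: measurableT_comp.
apply: (@sub_finite_set _ _ (Num.norm @` range f)); last exact: finite_image.
by move=> _ [x _ <-]; exists (f x) => //; exists x.
Qed.

Lemma simple_L1_indic B : measurable B -> (mu B < +oo)%E -> simple_L1 mu \1_B.
Proof.
move=> mB Boo; split; [exact: measurable_indic| |exact: L1_indic].
apply: (@sub_finite_set _ _ [set 0; 1]); last exact: finite_set2.
by move=> _ [x _ <-]; rewrite indicE; case: (x \in B); [right|left].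
Qed.

Lemma simple_L1_sfun (f : {sfun X >-> R}) : L1 mu f -> simple_L1 mu f.
Proof. by move=> If; split => //; exact: fimfunP. Qed.

(** On the level set [|f|] is the positive constant [|y|], so infinite measure would make its
    integral infinite. *)
Lemma simple_L1_preimage f y : simple_L1 mu f -> y != 0 ->
  measurable (f @^-1` [set y]) /\ (mu (f @^-1` [set y]) < +oo)%E.
Proof.
move=> [mf _ If] y0.
have mB : measurable (f @^-1` [set y]).
  by rewrite -[X in measurable X]setTI; exact: mf.
split=> //.
have : (\int[mu]_(x in f @^-1` [set y]) `|(f x)%:E| < +oo)%E.
  by have /integrableP[_] := integrableS measurableT mB (@subsetT _ _) If.
rewrite (eq_integral (fun=> `|y|%:E)); last first.
  by move=> x /set_mem /= ->.
rewrite integral_cst//; case: (mu _) (measure_ge0 mu (f @^-1` [set y])) => //=.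
  by move=> r _ _; rewrite ltry.
by move=> _; rewrite mulry gtr0_sg ?normr_gt0// mul1e.
Qed.

(** Reduces claims about simple functions to indicators: [f] is the sum, over its finite range, of
    [y] times the indicator of the level set of [y]. *)
Lemma simple_L1_ind (P : (X -> R) -> Prop) :
  (forall B, measurable B -> (mu B < +oo)%E -> P \1_B) ->
  (forall a f g, simple_L1 mu f -> simple_L1 mu g -> P f -> P g ->
    P (fun x => a * f x + g x)) ->
  forall f, simple_L1 mu f -> P f.
Proof.
move=> P1 Plin f sf; have [mf ff If] := sf.
have fE : f = fun x => \sum_(y <- fset_set (range f)) y * \1_(f @^-1` [set y]) x.
  apply/funext => x; rewrite (bigD1_seq (f x))/=; last 2 first.
  - by rewrite in_fset_set//; apply: mem_set; exists x.
  - exact: fset_uniq.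
  rewrite indicE mem_set// mulr1 big1 ?addr0// => y yfx.
  by rewrite indicE memNset ?mulr0// => /esym/eqP; apply/negP.
(* The sum runs over an arbitrary list to permit induction; simplicity is carried along because the
   linear step for [P] asks for it. *)
suff H (r : seq R) : let F x := \sum_(y <- r) y * \1_(f @^-1` [set y]) x in
    simple_L1 mu F /\ P F by rewrite fE; case: (H (fset_set (range f))).
elim: r => [|y r /= [IH1 IH2]] /=.
  rewrite (_ : (fun _ => _) = \1_set0).
    by split; [apply: simple_L1_indic|apply: P1] => //; rewrite measure0.
  by apply/funext => x; rewrite big_nil indic0.
under eq_fun do rewrite big_cons.
(* The value 0 is dropped: its level set may have infinite measure. *)
have [->|y0] := eqVneq y 0.
  by under eq_fun do rewrite mul0r add0r.
have [mB Boo] := simple_L1_preimage sf y0.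
split; first by apply: simple_L1_lin => //; exact: simple_L1_indic.
by apply: Plin => //; [exact: simple_L1_indic|exact: P1].
Qed.

Lemma simple_L1_dense f e : L1 mu f -> 0 < e ->
  exists2 s, simple_L1 mu s & dist1 f s < e.
Proof.
move=> If e0; have [s [Is _]] := approximation_sfun_integrable measurableT If.
move=> /fine_cvgP[_ /cvgrPdist_lt/(_ _ e0)[n _ /(_ n (leqnn n))]].
rewrite sub0r normrN => h; exists (s n); first exact: simple_L1_sfun (Is n).
by apply: le_lt_trans h; apply: ler_norm.
Qed.

(* The exceptional null set has to be removed before the pointwise monotone
   convergence theorem applies. *)
Lemma ae_monotone_L1_cvg (u : nat -> X -> R) (c : R) :
  (forall n, L1 mu (u n)) -> (forall n, ae_nonneg mu (u n)) ->
  (forall n, {ae mu, forall x, u n x <= u n.+1 x}) ->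
  (forall n, \int[mu]_x u n x <= c) ->
  exists g, [/\ L1 mu g, ae_nonneg mu g & dist1 (u n) g @[n --> \oo] --> 0].
Proof.
move=> Iu u0 uS uc.
have [N [mN N0 subN]] : {ae mu, forall x, forall n, 0 <= u n x <= u n.+1 x}.
  apply/ae_foralln => n; move: (u0 n) (uS n); apply: filterS2 => x -> ->//.
have outN x : ~ N x -> forall n, 0 <= u n x <= u n.+1 x.
  by move=> Nx; apply: contrapT => h; apply: Nx; apply: subN.
pose v n x := u n x * \1_(~` N) x.
have v0 n x : 0 <= v n x.
  rewrite /v indicE; have [/set_mem/outN/(_ n)/andP[? _]|] := boolP (x \in ~` N).
    by rewrite mulr1.
  by rewrite mulr0.
have vS x : nondecreasing_seq (fun n => (v n x)%:E).
  apply/nondecreasing_seqP => n; rewrite lee_fin /v indicE.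
  have [/set_mem/outN/(_ n)/andP[_ ?]|] := boolP (x \in ~` N); rewrite ?mulr1//.
  by rewrite !mulr0.
have mv n : measurable_fun setT (v n).
  apply: measurable_funM; first exact: L1_measurable.
  by apply: measurable_indic; exact: measurableC.
have vu n : aeeq mu (v n) (u n).
  exists N; split => // x /=; apply: contra_notP => Nx.
  by rewrite /v indicE mem_set// mulr1.
have Iv n : L1 mu (v n).
  apply: L1_le (Iu n) => // x; rewrite /v indicE.
  by case: (_ \in _); rewrite ?mulr1// mulr0 normr0.
(* In the extended reals the limit exists everywhere; the bound [c] makes it integrable, hence
   finite almost everywhere. *)
pose G x : \bar R := limn (fun n => (v n x)%:E).
have cvG x : (v n x)%:E @[n --> \oo] --> G x.
  exact: ereal_nondecreasing_is_cvgn.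
have G0 x : (0 <= G x)%E.
  by apply: lime_ge; [exact: ereal_nondecreasing_is_cvgn|apply: nearW => n];
    rewrite lee_fin.
have mG : measurable_fun setT G.
  by apply: (emeasurable_fun_cvg (fun n x => (v n x)%:E)) => // n;
    exact/measurable_EFinP.
have vG n x : ((v n x)%:E <= G x)%E.
  apply: lime_ge; first exact: ereal_nondecreasing_is_cvgn.
  by exists n => // m /= nm; exact: vS.
have IG : mu.-integrable setT G.
  apply/integrableP; split => //.
  under eq_integral do rewrite gee0_abs//.
  rewrite (monotone_convergence mu measurableT) => //=.
  - apply: (@le_lt_trans _ _ c%:E); last by rewrite ltry.
    apply: lime_le.
      apply: ereal_nondecreasing_is_cvgn => m n mn.
      apply: ge0_le_integral => //=.
      - by move=> x _; rewrite lee_fin.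
      - exact/measurable_EFinP.
      - exact/measurable_EFinP.
      - by move=> x _; exact: vS.
    apply: nearW => n; rewrite L1_integralE// lee_fin.
    by rewrite (Rintegral_ae_eq (Iv n) (Iu n)).
  - by move=> n; exact/measurable_EFinP.
  - by move=> n x _; rewrite lee_fin.
(* [fine] sends [+oo] to 0, which alters [G] only on a null set and keeps [g] nonnegative
   everywhere. *)
pose g x := fine (G x).
have mg : measurable_fun setT g by exact: measurableT_comp.
have Gg : {ae mu, forall x, G x = (g x)%:E}.
  have := integrable_ae measurableT IG.
  by apply: filterS => x /(_ I) ?; rewrite fineK.
(* [G] itself dominates every [v n], which turns pointwise convergence into L^1 convergence. *)
have [|||||/= Ig vg _] := @dominated_convergence _ _ _ mu _ measurableT
  (fun n x => (v n x)%:E) (EFin \o g) G.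
- by move=> n; exact/measurable_EFinP.
- exact/measurable_EFinP.
- by apply: filterS Gg => x /= <- _; exact: cvG.
- exact: IG.
- by apply: aeW => x n _; rewrite /= ger0_norm.
exists g; split => //; first by apply: aeW => x; exact: fine_ge0.
have -> : (fun n => dist1 (u n) g) = (fun n => dist1 (v n) g).
  apply/funext => n; apply: Rintegral_ae_eq; [exact: L1_dist..|].
  by apply: filterS (vu n) => x ->.
by move/fine_cvgP : vg => [].
Qed.

End L1_theory.

(** * Positive integral-preserving operators on Riesz subspaces of L^1 *)

Section markov_on.
Set Implicit Arguments.
Unset Strict Implicit.
Context (d : measure_display) (X : measurableType d) (R : realType)
        (mu : {measure set X -> \bar R}).
Implicit Types (f g : X -> R) (a : R) (P : (X -> R) -> Prop)
        (Op : (X -> R) -> (X -> R)).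

Definition riesz_subspace P : Prop :=
  [/\ forall f, P f -> L1 mu f,
      forall a f g, P f -> P g -> P (fun x => a * f x + g x) &
      forall f, P f -> P (fun x => `|f x|)].

(* Both [S] on the simple functions and its extension to [L1] are instances, so
   that one contraction estimate covers the two. *)
Definition markov_on P Op : Prop :=
  [/\ forall f, P f -> L1 mu (Op f),
      forall a f g, P f -> P g ->
        aeeq mu (Op (fun x => a * f x + g x)) (fun x => a * Op f x + Op g x),
      forall f, P f -> ae_nonneg mu f -> ae_nonneg mu (Op f) &
      forall f, P f -> \int[mu]_x Op f x = \int[mu]_x f x].

Lemma riesz_subspace_L1 : riesz_subspace (L1 mu).
Proof. by split => // [a f g|f]; [exact: L1_lin|exact: L1_abs]. Qed.

Lemma riesz_subspace_simple : riesz_subspace (simple_L1 mu).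
Proof.
by split => [f|a f g|f]; [exact: simple_L1_L1|exact: simple_L1_lin|
  exact: simple_L1_abs].
Qed.

(* [|Op f| <= Op |f|] almost everywhere, because [|f| + f] and [|f| - f] are
   nonnegative. *)
Lemma markov_on_contraction P Op f : riesz_subspace P -> markov_on P Op -> P f ->
  \int[mu]_x `|Op f x| <= \int[mu]_x `|f x|.
Proof.
move=> [PL1 Plin Pabs] [OL1 Olin O0 OI] Pf.
rewrite -(OI _ (Pabs _ Pf)); apply: Rintegral_ae_le.
- by apply: L1_abs; exact: OL1.
- by apply: OL1; exact: Pabs.
have p1 : {ae mu, forall x, 0 <= Op (fun x => 1 * f x + `|f x|) x}.
  apply: O0; first by apply: Plin => //; exact: Pabs.
  by apply: aeW => x; have := ler_norm (- f x); rewrite normrN; lra.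
have p2 : {ae mu, forall x, 0 <= Op (fun x => -1 * f x + `|f x|) x}.
  apply: O0; first by apply: Plin => //; exact: Pabs.
  by apply: aeW => x; have := ler_norm (f x); lra.
have q1 := Olin 1 f _ Pf (Pabs _ Pf); have q2 := Olin (-1) f _ Pf (Pabs _ Pf).
near=> x; rewrite ler_norml.
have e1 : Op (fun x => 1 * f x + `|f x|) x =
  1 * Op f x + Op (fun x => `|f x|) x by near: x.
have e2 : Op (fun x => -1 * f x + `|f x|) x =
  -1 * Op f x + Op (fun x => `|f x|) x by near: x.
have l1 : 0 <= Op (fun x => 1 * f x + `|f x|) x by near: x.
have l2 : 0 <= Op (fun x => -1 * f x + `|f x|) x by near: x.
by rewrite e1 in l1; rewrite e2 in l2; lra.
Unshelve. all: by end_near. Qed.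

Lemma markov_on_dist1 P Op f g : riesz_subspace P -> markov_on P Op ->
  P f -> P g -> dist1 mu (Op f) (Op g) <= dist1 mu f g.
Proof.
move=> rP mO Pf Pg; have [PL1 Plin Pabs] := rP; have [OL1 Olin _ _] := mO.
(* The difference [f - g] is written in the shape [a * g + f] to which linearity of [Op] applies. *)
have Pfg := Plin (-1) g f Pg Pf.
have -> : dist1 mu f g = \int[mu]_x `|-1 * g x + f x|.
  by apply: eq_Rintegral => x _; congr (`|_|); lra.
apply: le_trans _ (markov_on_contraction rP mO Pfg).
rewrite le_eqVlt; apply/orP; left; apply/eqP; apply: Rintegral_ae_eq.
- by apply: L1_dist; apply: OL1.
- by apply: L1_abs; apply: OL1.
- by apply: filterS (Olin (-1) g f Pg Pf) => x ->; congr (`|_|); lra.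
Qed.

(** Respect for almost everywhere equality follows from contraction, the distance of [f] and [g]
    being 0. *)
Lemma markov_on_ae_eq P Op f g : riesz_subspace P -> markov_on P Op ->
  P f -> P g -> aeeq mu f g -> aeeq mu (Op f) (Op g).
Proof.
move=> rP mO Pf Pg fg; have [PL1 _ _] := rP; have [OL1 _ _ _] := mO.
apply: dist1_ae_eq; [exact: OL1..|] => e e0.
apply: le_trans (markov_on_dist1 rP mO Pf Pg) _.
by rewrite ae_eq_dist1 ?ltW//; exact: PL1.
Qed.

Lemma markov_operatorP Op :
  markov_operator mu Op <-> markov_on (L1 mu) Op.
Proof.
split=> [[[OL1 _ Olin] O0 OI]|mO].
  by split=> // f If; have := OI _ If; rewrite /Rintegral => ->.
have [OL1 Olin O0 OI] := mO; split=> //.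
  by split=> // f g If Ig; exact: markov_on_ae_eq riesz_subspace_L1 mO If Ig.
by move=> f If; rewrite !L1_integralE// ?OI//; exact: OL1.
Qed.

(** For integrable [f], this is membership of the pair in the L^1 closure of the graph of [Op] over
    simple functions: one [s] must serve both coordinates. *)
Definition closure_graph Op f g : Prop := L1 mu g /\ forall e, 0 < e ->
  exists s, [/\ simple_L1 mu s, dist1 mu f s < e & dist1 mu g (Op s) < e].

(** * Extension of a Markov operator from simple functions to L^1 *)

Section closure_graph.
Variable S : (X -> R) -> (X -> R).
Hypothesis mS : markov_on (simple_L1 mu) S.

Let SL1 f : simple_L1 mu f -> L1 mu (S f). Proof. by case: mS => + _ _ _; exact. Qed.

(** Contraction of [S] survives the closure; this bound makes the closure single-valued and later
    transfers positivity. *)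
Lemma closure_graph_dist1 f1 g1 f2 g2 : L1 mu f1 -> L1 mu f2 ->
  closure_graph S f1 g1 -> closure_graph S f2 g2 ->
  dist1 mu g1 g2 <= dist1 mu f1 f2.
Proof.
move=> If1 If2 [Ig1 H1] [Ig2 H2]; apply/ler_addgt0Pr => e e0.
(* Four errors are incurred: replacing each [f] by its [s], and each [g] by [S s]. *)
have e40 : 0 < e / 4 by rewrite divr_gt0.
have [s1 [ss1 fs1 gs1]] := H1 _ e40; have [s2 [ss2 fs2 gs2]] := H2 _ e40.
have Is1 := simple_L1_L1 ss1; have Is2 := simple_L1_L1 ss2.
have := markov_on_dist1 (@riesz_subspace_simple) mS ss1 ss2.
have := dist1_triangle Ig1 (SL1 ss1) Ig2.
have := dist1_triangle (SL1 ss1) (SL1 ss2) Ig2.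
have := dist1_triangle Is1 If1 Is2.
have := dist1_triangle If1 If2 Is2.
by move: fs1 fs2 gs1 gs2; rewrite (dist1C _ (S s2)) (dist1C _ s1 f1); lra.
Qed.

Lemma closure_graph_lin a f1 g1 f2 g2 : L1 mu f1 -> L1 mu f2 ->
  closure_graph S f1 g1 -> closure_graph S f2 g2 ->
  closure_graph S (fun x => a * f1 x + f2 x) (fun x => a * g1 x + g2 x).
Proof.
move=> If1 If2 [Ig1 H1] [Ig2 H2]; split; first exact: L1_lin.
(* The two errors add up to at most [|a| * (e / k) + e / k = e]; adding 1 also keeps [k] positive
   when [a = 0]. *)
move=> e e0; pose k := `|a| + 1.
have k0 : 0 < k by rewrite /k ltr_wpDl.
have ek0 : 0 < e / k by rewrite divr_gt0.
have [s1 [ss1 fs1 gs1]] := H1 _ ek0.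
have [s2 [ss2 fs2 gs2]] := H2 _ ek0.
have Is1 := simple_L1_L1 ss1; have Is2 := simple_L1_L1 ss2.
have bnd u v : u < e / k -> v < e / k -> `|a| * u + v < e.
  move=> ue ve; apply: (@le_lt_trans _ _ (`|a| * (e / k) + v)).
    by rewrite lerD2r ler_wpM2l// ltW.
  have {2}-> : e = `|a| * (e / k) + e / k.
    by rewrite -[X in _ = _ + X]mul1r -mulrDl -/k mulrC divfK// gt_eqF.
  by rewrite ltrD2l.
exists (fun x => a * s1 x + s2 x); split; first exact: simple_L1_lin.
  exact: le_lt_trans (dist1_lin _ _ _ _ _) (bnd _ _ fs1 fs2).
apply: le_lt_trans (bnd _ _ gs1 gs2).
apply: le_trans _ (dist1_lin a Ig1 Ig2 (SL1 ss1) (SL1 ss2)).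
have [_ Slin _ _] := mS; have := Slin a _ _ ss1 ss2 => h.
have I1 := SL1 (simple_L1_lin a ss1 ss2).
have I2 := L1_lin a (SL1 ss1) (SL1 ss2).
have Ig := L1_lin a Ig1 Ig2.
apply: le_trans (dist1_triangle Ig I2 I1) _.
by rewrite (dist1C _ _ (S _)) (ae_eq_dist1 I1 I2 h) addr0.
Qed.

Lemma closure_graph_simple s : simple_L1 mu s -> closure_graph S s (S s).
Proof.
move=> ss; split; first exact: SL1.
move=> e e0; exists s; split => //; rewrite ae_eq_dist1//.
- exact: simple_L1_L1.
- exact: simple_L1_L1.
- exact: aeW.
- exact: SL1.
- exact: SL1.
- exact: aeW.
Qed.

Lemma closure_graph_ge0 f : L1 mu f -> (forall x, 0 <= f x) ->
  exists2 g, closure_graph S f g & ae_nonneg mu g.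
Proof.
move=> If f0; have mf : measurable_fun setT (EFin \o f) by exact: measurable_int If.
pose s n : X -> R := nnsfun_approx measurableT mf n.
have s0 n x : 0 <= s n x by [].
have sS n x : s n x <= s n.+1 x.
  by have /nondecreasing_seqP/(_ n)/lefP := nd_nnsfun_approx measurableT mf; apply.
have sf n x : s n x <= f x.
  rewrite /s nnsfun_approxE -lee_fin; apply: le_approx => // y _.
  by rewrite lee_fin.
have ms n : measurable_fun setT (s n) by [].
have Is n : L1 mu (s n).
  by apply: L1_le If => // x; rewrite !ger0_norm.
have ss n : simple_L1 mu (s n) by split => //; exact: fimfunP.
have [_ Slin S0 SI] := mS.
(* Positivity on [s n.+1 - s n] makes [S (s n)] increase almost everywhere; preservation of
   integrals bounds the integrals by that of [f]. *)
have [n|n|n|n|g [Ig g0 Sg]] := @ae_monotone_L1_cvg _ _ _ mu (S \o s) (\int[mu]_x f x).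
- exact: SL1.
- by apply: S0 => //; exact: aeW.
- have h1 := Slin (-1) _ _ (ss n) (ss n.+1).
  have h2 : ae_nonneg mu (S (fun x => -1 * s n x + s n.+1 x)).
    apply: S0; first exact: simple_L1_lin.
    by apply: aeW => x; have := sS n x; lra.
  by move: h1 h2; apply: filterS2 => x /= ->; lra.
- by rewrite SI//; apply: (le_Rintegral measurableT (Is n) If) => x _.
have [|||||/= _ fs _] := @dominated_convergence _ _ _ mu _ measurableT
  (fun n x => (s n x)%:E) (EFin \o f) (EFin \o f).
- by move=> n; exact/measurable_EFinP.
- by [].
- by apply: aeW => x _; apply: cvg_nnsfun_approx => // y _; rewrite lee_fin.
- exact: If.
- by apply: aeW => x n _; rewrite /= ger0_norm ?lee_fin.
move/fine_cvgP : fs => [_ fs].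
exists g => //; split => // e e0.
move/cvgrPdist_lt : Sg => /(_ _ e0) Sg.
move/cvgrPdist_lt : fs => /(_ _ e0) fs.
(* One large [n] brings [s n] close to [f] and [S (s n)] close to [g] at once. *)
near \oo => n; exists (s n); split => //.
  rewrite dist1C; have : `|0 - dist1 mu (s n) f| < e by near: n.
  by rewrite sub0r normrN ger0_norm// dist1_ge0.
rewrite dist1C; have : `|0 - dist1 mu (S (s n)) g| < e by near: n.
by rewrite sub0r normrN ger0_norm// dist1_ge0.
Unshelve. all: by end_near. Qed.

Lemma closure_graph_exists f : L1 mu f -> exists g, closure_graph S f g.
Proof.
move=> If.
have Ip : L1 mu (f^\+) by exact: integrable_funrpos.
have In : L1 mu (f^\-) by exact: integrable_funrneg.
have [p Gp _] := closure_graph_ge0 Ip (@funrpos_ge0 _ _ f).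
have [n Gn _] := closure_graph_ge0 In (@funrneg_ge0 _ _ f).
exists (fun x => -1 * n x + p x).
rewrite (_ : f = fun x => -1 * f^\- x + f^\+ x); first exact: closure_graph_lin.
by apply/funext => x; rewrite -{1}(funrposBneg f) mulN1r addrC.
Qed.

Lemma closure_graph_uniq f g1 g2 : L1 mu f ->
  closure_graph S f g1 -> closure_graph S f g2 -> aeeq mu g1 g2.
Proof.
move=> If G1 G2; apply: dist1_ae_eq; [by case: G1|by case: G2|] => e e0.
apply: le_trans (closure_graph_dist1 If If G1 G2) _.
by rewrite ae_eq_dist1 ?ltW//; exact: aeW.
Qed.

Lemma markov_extension_exists : exists Op,
  markov_on (L1 mu) Op /\ forall f, simple_L1 mu f -> aeeq mu (Op f) (S f).
Proof.
(* Outside L^1 the value of [Op] is unconstrained, and [f] serves as a default. *)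
have /choice[Op GOp] f : exists g, L1 mu f -> closure_graph S f g.
  have [/closure_graph_exists[g Gg]|nIf] := pselect (L1 mu f); first by exists g.
  by exists f.
exists Op; split; last first.
  move=> f sf; have If := simple_L1_L1 sf.
  by apply: (closure_graph_uniq If (GOp _ If)); exact: closure_graph_simple.
split.
- by move=> f /GOp[].
- move=> a f g If Ig; have Ifg := L1_lin a If Ig.
  by apply: (closure_graph_uniq Ifg (GOp _ Ifg)); apply: closure_graph_lin;
    auto.
(* [closure_graph_ge0] asks for nonnegativity at every point, so it is applied to [|f|], which
   equals [f] almost everywhere; the distance bound then identifies [Op f] with [g]. *)
- move=> f If f0; have Ia := L1_abs If.
  have [g Gg g0] := closure_graph_ge0 Ia (fun x => normr_ge0 (f x)).
  suff h : aeeq mu (Op f) g by move: h g0; apply: filterS2 => x ->.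
  have Ig : L1 mu g by case: Gg.
  have IO : L1 mu (Op f) by case: (GOp _ If).
  apply: dist1_ae_eq => // e e0.
  apply: le_trans (closure_graph_dist1 If Ia (GOp _ If) Gg) _.
  rewrite ae_eq_dist1 ?ltW//.
  by apply: filterS f0 => x /ger0_norm ->.
- move=> f If; have [IO H] := GOp _ If.
  apply/eqP; rewrite -subr_eq0 -normr_le0; apply/ler_addgt0Pr => e e0.
  (* The integrals of [Op f] and [S s] differ by less than [e / 2], as do those of [f] and [s],
     while [S s] and [s] have equal integrals. *)
  have [s [ss fs gs]] := H _ (divr_gt0 e0 (ltr0n _ 2)).
  have Is := simple_L1_L1 ss.
  have := dist1_integral If Is; have := dist1_integral IO (SL1 ss).
  have [_ _ _ SI] := mS; rewrite (SI _ ss) !ler_norml.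
  by move=> /andP[? ?] /andP[? ?]; apply/andP; split; lra.
Qed.

(** The graph of any Markov extension lies in the closure of the graph of [S], since by contraction
    [s] near [f] puts [S s] near [Op f]; the closure is single-valued. *)
Lemma markov_extension_uniq Op1 Op2 f :
  markov_on (L1 mu) Op1 -> (forall s, simple_L1 mu s -> aeeq mu (Op1 s) (S s)) ->
  markov_on (L1 mu) Op2 -> (forall s, simple_L1 mu s -> aeeq mu (Op2 s) (S s)) ->
  L1 mu f -> aeeq mu (Op1 f) (Op2 f).
Proof.
suff ext Op : markov_on (L1 mu) Op ->
    (forall s, simple_L1 mu s -> aeeq mu (Op s) (S s)) ->
    L1 mu f -> closure_graph S f (Op f).
  by move=> m1 e1 m2 e2 If; apply: (closure_graph_uniq If); exact: ext.
move=> mO eO If; have [OL1 _ _ _] := mO; split; first exact: OL1.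
move=> e e0; have [s ss fs] := simple_L1_dense If e0.
exists s; split => //; have Is := simple_L1_L1 ss.
apply: le_lt_trans fs; apply: le_trans (markov_on_dist1 riesz_subspace_L1 mO If Is).
apply: le_trans (dist1_triangle (OL1 _ If) (OL1 _ Is) (SL1 ss)) _.
by rewrite (ae_eq_dist1 (OL1 _ Is) (SL1 ss) (eO _ ss)) addr0.
Qed.

End closure_graph.
End markov_on.

(** The finiteness hypotheses are packed into structures: [mu'] and [nu'] are the same measures as
    [mu] and [nu]. *)
Lemma radon_nikodym_unbundled (d : measure_display) (X : measurableType d)
    (R : realType) (mu nu : {measure set X -> \bar R}) :
  sigma_finite setT mu -> (nu setT < +oo)%E -> nu `<< mu ->
  exists f : X -> \bar R, [/\ forall x, (0 <= f x)%E,
    forall x, f x \is a fin_num, mu.-integrable setT f &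
    forall B, measurable B -> nu B = (\int[mu]_(x in B) f x)%E].
Proof.
move=> sf_mu nuT; have fin_nu := lty_fin_num_fun nuT.
have sf_nu : sigma_finite setT nu.
  by apply: fin_num_fun_sigma_finite => //; rewrite measure0.
pose mu1 := isSFinite.Build _ _ _ _ (sfinite_measure_sigma_finite sf_mu).
pose mu2 := isSigmaFinite.Build _ _ _ _ sf_mu.
pose mu' := HB.pack_for (SigmaFiniteMeasure.type X R) (Measure.sort mu) mu1 mu2.
pose nu1 := isSFinite.Build _ _ _ _ (sfinite_measure_sigma_finite sf_nu).
pose nu2 := isSigmaFinite.Build _ _ _ _ sf_nu.
pose nu3 := isFinite.Build _ _ _ _ fin_nu.
pose nu' := HB.pack_for (FiniteMeasure.type X R) (Measure.sort nu) nu1 nu2 nu3.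
have muE : mu = mu' by exact: eq_measure.
move=> nu_mu; rewrite muE.
exact: (@radon_nikodym_sigma_finite _ _ _ mu' nu').
Qed.
Arguments radon_nikodym_unbundled {d X R mu nu}.

(** * Representation of a positive functional on L^1 by a density bounded by 1 *)

Section positive_functional.
Set Implicit Arguments.
Unset Strict Implicit.
Context (d : measure_display) (X : measurableType d) (R : realType)
        (mu : {measure set X -> \bar R}) (A : nat -> set X)
        (phi : (X -> R) -> R) (c : R).
Implicit Types (f g : X -> R) (a : R) (B F : set X).
Hypothesis mA : forall n, measurable (A n).
Hypothesis Aoo : forall n, (mu (A n) < +oo)%E.
Hypothesis AS : forall n, A n `<=` A n.+1.
Hypothesis AT : setT = \bigcup_n A n.
Hypothesis phi_lin : forall a f g, L1 mu f -> L1 mu g ->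
  phi (fun x => a * f x + g x) = a * phi f + phi g.
Hypothesis phi_ge0 : forall f, L1 mu f -> (forall x, 0 <= f x) -> 0 <= phi f.
Hypothesis phi_le : forall f, L1 mu f -> (forall x, 0 <= f x) ->
  phi f <= \int[mu]_x f x.
Hypothesis phi_A : forall n, phi \1_(A n) <= c.

Let indic_nonneg B x : 0 <= \1_B x :> R.
Proof. by []. Qed.

(** Positivity and [-|h| <= h <= |h|] give [|phi h| <= phi |h|], which [phi_le] bounds by the
    integral of [|h|]. *)
Let phi_dist1 f g : L1 mu f -> L1 mu g -> `|phi f - phi g| <= dist1 mu f g.
Proof.
move=> If Ig; have Ifg := L1_lin (-1) Ig If.
have -> : phi f - phi g = phi (fun x => -1 * g x + f x) by rewrite phi_lin//; lra.
have Ia := L1_abs Ifg.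
have -> : dist1 mu f g = \int[mu]_x `|-1 * g x + f x|.
  by apply: eq_Rintegral => x _; congr (`|_|); lra.
set h := (fun x => -1 * g x + f x) in Ifg Ia *.
apply: le_trans (phi_le Ia (fun x => normr_ge0 (h x))).
have h1 : 0 <= phi (fun x => -1 * h x + `|h x|).
  by apply: phi_ge0; [exact: L1_lin|move=> x; have := ler_norm (h x); lra].
have h2 : 0 <= phi (fun x => 1 * h x + `|h x|).
  apply: phi_ge0; first exact: L1_lin.
  by move=> x; have := ler_norm (- h x); rewrite normrN; lra.
rewrite phi_lin// in h1; rewrite phi_lin// in h2; rewrite ler_norml.
by apply/andP; split; lra.
Qed.

Let phi_set0 : phi \1_set0 = 0.
Proof.
rewrite indic0; apply/eqP; rewrite eq_le.
rewrite phi_ge0//; last exact: L1_cst0.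
rewrite andbT; apply: le_trans (phi_le _ _) _ => //; first exact: L1_cst0.
by rewrite Rintegral_cst// mul0r.
Qed.

Let phi_indic_ge0 B : measurable B -> (mu B < +oo)%E -> 0 <= phi \1_B.
Proof. by move=> mB Boo; apply: phi_ge0 => //; exact: L1_indic. Qed.

Let phi_setU B F : measurable B -> (mu B < +oo)%E -> measurable F ->
  (mu F < +oo)%E -> B `&` F = set0 -> phi \1_(B `|` F) = phi \1_B + phi \1_F.
Proof.
move=> mB Boo mF Foo BF0; have IB := L1_indic mB Boo; have IF := L1_indic mF Foo.
rewrite -[phi \1_B]mul1r -phi_lin//; congr phi; apply/funext => x.
rewrite !indicE mul1r in_setU.
have [xB|] := boolP (x \in B); have [xF|] := boolP (x \in F); rewrite /= ?addr0 ?add0r//.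
have : (B `&` F) x by split; exact: set_mem.
by rewrite BF0.
Qed.

Let mu_sub_lty B F : measurable B -> measurable F -> B `<=` F ->
  (mu F < +oo)%E -> (mu B < +oo)%E.
Proof. by move=> mB mF BF; apply: le_lt_trans; rewrite le_measure ?mem_set. Qed.

Let phi_bigsetU (F : nat -> set X) n : (forall k, measurable (F k)) ->
  (forall k, (mu (F k) < +oo)%E) -> trivIset setT F ->
  phi \1_(\big[setU/set0]_(i < n) F i) = \sum_(0 <= i < n) phi \1_(F i).
Proof.
move=> mF Foo tF; elim: n => [|n IH]; first by rewrite big_ord0 big_nil.
have mV : measurable (\big[setU/set0]_(i < n) F i) by exact: bigsetU_measurable.
rewrite big_ord_recr big_nat_recr//= -IH phi_setU//.
- apply: le_lt_trans (Boole_inequality mu (fun i _ => mF i)) _.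
  by apply: lte_sum_pinfty => i _; exact: Foo.
- apply/seteqP; split=> // x [+ Fnx]; rewrite -bigcup_mkord => -[k /= kn Fkx].
  have kE : k = n by apply: tF => //; exists x.
  by rewrite kE ltnn in kn.
Qed.

(* [0 <= phi \1_U - phi \1_V <= mu (U `\` V)] for [V `<=` U], so that countable
   additivity is inherited from [mu]. *)
Let phi_sigma_additive (F : nat -> set X) : (forall k, measurable (F k)) ->
  trivIset setT F -> (mu (\bigcup_k F k) < +oo)%E ->
  \sum_(0 <= i < n) phi \1_(F i) @[n --> \oo] --> phi \1_(\bigcup_k F k).
Proof.
set U := \bigcup_k F k => mF tF Uoo.
have mU : measurable U by exact: bigcup_measurable.
have FU k : F k `<=` U by exact: bigcup_sup.
have Foo k : (mu (F k) < +oo)%E by exact: mu_sub_lty Uoo.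
pose V n := \big[setU/set0]_(i < n) F i.
have mV n : measurable (V n) by exact: bigsetU_measurable.
have VU n : V n `<=` U.
  by move=> x; rewrite /V -bigcup_mkord => -[k _ Fkx]; exists k.
have Voo n : (mu (V n) < +oo)%E by exact: mu_sub_lty Uoo.
have Vcvg : fine (mu (V n)) @[n --> \oo] --> fine (mu U).
  apply: fine_cvg; rewrite fineK ?ge0_fin_numE//.
  have -> : U = \bigcup_n V n.
    apply/seteqP; split=> [x [k _ Fkx]|x [n _ /VU//]].
    by exists k.+1 => //; rewrite /V big_ord_recr; right.
  apply: (@nondecreasing_cvg_mu _ _ _ mu V) => //.
    by apply: bigcup_measurable.
  by move=> m n mn; apply/subsetPset; exact: subset_bigsetU.
under eq_fun do rewrite -phi_bigsetU//.
set p := phi \1_U.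
apply: (@squeeze_cvgr _ _ _ _ (fun n => p - (fine (mu U) - fine (mu (V n))))
  (fun=> p)); last 2 first.
- rewrite -[X in _ --> X]subr0 -[X in _ - X](subrr (fine (mu U))).
  by apply: cvgB; [exact: cvg_cst|apply: cvgB => //; exact: cvg_cst].
- exact: cvg_cst.
apply: nearW => n.
have mUV : measurable (U `\` V n) by exact: measurableD.
have UVoo : (mu (U `\` V n) < +oo)%E by exact: mu_sub_lty Uoo.
have -> : fine (mu U) - fine (mu (V n)) = fine (mu (U `\` V n)).
  have Ufin : mu U \is a fin_num by rewrite ge0_fin_numE.
  have Vfin : mu (V n) \is a fin_num by rewrite ge0_fin_numE// Voo.
  by rewrite measureD// (setIidr (VU n)) fineB.
have -> : p = phi \1_(V n) + phi \1_(U `\` V n).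
  rewrite /p -phi_setU//; last by rewrite setDIK.
  by rewrite setDUK.
have := phi_indic_ge0 mUV UVoo.
have := phi_le (L1_indic mUV UVoo) (@indic_nonneg _).
by rewrite Rintegral_indic//; lra.
Qed.

(** The successive differences of [A] split the space into disjoint pieces of finite measure, on
    each of which [phi] induces a measure. *)
Let D := seqD A.

Let ndA : nondecreasing_seq A.
Proof. by apply/nondecreasing_seqP => n; apply/subsetPset. Qed.

Let mD n : measurable (D n).
Proof. by case: n => [|n]; [exact: mA|apply: measurableD; exact: mA]. Qed.

Let Doo n : (mu (D n) < +oo)%E.
Proof. by apply: mu_sub_lty (Aoo n) => //; case: n => //= n x []. Qed.

Let BD_lty B n : measurable B -> (mu (B `&` D n) < +oo)%E.
Proof. by move=> mB; apply: mu_sub_lty (Doo n) => //; exact: measurableI. Qed.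

(* The absolute value only matters on non-measurable sets, where a measure is
   still required to be nonnegative. *)
Let nu_ k B : \bar R := `|phi \1_(B `&` D k)|%:E.

Let nu_E k B : measurable B -> nu_ k B = (phi \1_(B `&` D k))%:E.
Proof.
move=> mB; rewrite /nu_ ger0_norm//; apply: phi_indic_ge0; last exact: BD_lty.
exact: measurableI.
Qed.

Let nu_set0 k : nu_ k set0 = 0%E.
Proof. by rewrite /nu_ set0I phi_set0 normr0. Qed.

Let nu_ge0 k B : (0 <= nu_ k B)%E.
Proof. by rewrite lee_fin. Qed.

(** Any union has finite measure once cut by [D k], so [phi_sigma_additive] applies. *)
Let nu_sigma_additive k : semi_sigma_additive (nu_ k).
Proof.
move=> F mF tF mU; rewrite nu_E//.
under eq_fun do (under eq_bigr do rewrite nu_E//; rewrite sumEFin).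
apply/cvg_EFin; first exact: nearW.
rewrite setI_bigcupl; apply: phi_sigma_additive.
- by move=> i; exact: measurableI.
- exact: trivIset_setIr.
- by rewrite -setI_bigcupl; exact: BD_lty.
Qed.

HB.instance Definition _ k := isMeasure.Build _ _ _ (nu_ k)
  (nu_set0 k) (nu_ge0 k) (@nu_sigma_additive k).

(** Summing over the pieces also covers sets of infinite measure, whose indicators are not in
    L^1. *)
Let nu : {measure set X -> \bar R} :=
  mseries (fun k => nu_ k : {measure set X -> \bar R}) 0.

Let nu_finE B : measurable B -> (mu B < +oo)%E -> nu B = (phi \1_B)%:E.
Proof.
move=> mB Boo; apply/cvg_lim => //.
under eq_fun do (under eq_bigr do rewrite /= nu_E//; rewrite sumEFin).
have BE : B = \bigcup_k (B `&` D k).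
  by rewrite -setI_bigcupr eq_bigcup_seqD -AT setIT.
apply/cvg_EFin; first exact: nearW.
rewrite [X in _ --> phi (\1_X)]BE; apply: phi_sigma_additive.
- by move=> i; exact: measurableI.
- by apply: trivIset_setIl; exact: trivIset_seqD.
- by rewrite -BE.
Qed.

Let nu_setT : (nu setT <= c%:E)%E.
Proof.
apply: lime_le; first by apply: is_cvg_nneseries => *; exact: nu_ge0.
apply: nearW => n.
under eq_bigr do rewrite /= nu_E// setTI.
rewrite sumEFin lee_fin -phi_bigsetU//; last exact: trivIset_seqD.
(* The first [n.+1] pieces unite to [A n], where [phi_A] applies; for the empty union, [phi_A 0]
   shows that [c] is nonnegative. *)
case: n => [|n]; last by rewrite nondecreasing_bigsetU_seqD.
rewrite big_ord0 phi_set0; apply: le_trans (phi_A 0).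
exact: phi_indic_ge0.
Qed.

Let nu_dominated : nu `<< mu.
Proof.
apply/null_content_dominatesP => B mB B0.
have Boo : (mu B < +oo)%E by rewrite B0.
rewrite nu_finE//; congr EFin; apply/eqP; rewrite eq_le phi_indic_ge0// andbT.
apply: le_trans (phi_le (L1_indic mB Boo) (@indic_nonneg _)) _.
by rewrite Rintegral_indic// B0.
Qed.

Let nu_density : exists h : X -> R, [/\ L1 mu h, forall x, 0 <= h x,
  (\int[mu]_x (h x)%:E <= c%:E)%E &
  forall B, measurable B -> (mu B < +oo)%E ->
    \int[mu]_x (h x * \1_B x) = phi \1_B].
Proof.
have sf_mu : sigma_finite setT mu by exists A => // n; split.
have [h [h0 hfin Ih hE]] :=
  radon_nikodym_unbundled sf_mu (le_lt_trans nu_setT (ltry c)) nu_dominated.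
have hK : (fun x => (fine (h x))%:E) = h by apply/funext => x; rewrite fineK.
exists (fine \o h); split.
- by rewrite /L1 /comp hK.
- by move=> x; exact: fine_ge0.
- by rewrite /= hK -hE.
move=> B mB Boo; rewrite /Rintegral.
have -> : (\int[mu]_x ((fine \o h) x * \1_B x)%:E = \int[mu]_(x in B) h x)%E.
  rewrite [RHS]integral_mkcond; apply: eq_integral => x _.
  rewrite patchE indicE; case: ifPn => _; last by rewrite mulr0.
  by rewrite mulr1 fineK.
by rewrite -hE// nu_finE.
Qed.


(** Both sides of the final identity are linear and L^1-continuous in [f], so agreement on
    indicators, supplied by the density of [nu], suffices. *)
Lemma positive_functional_density : exists h : X -> R,
  [/\ measurable_fun setT h, forall x, 0 <= h x <= 1,
      (\int[mu]_x (h x)%:E <= c%:E)%E &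
      forall f, L1 mu f -> \int[mu]_x (h x * f x) = phi f].
Proof.
have [h0 [Ih0 h00 h0c h0B]] := nu_density.
have mh0 := L1_measurable Ih0.
have h01 : {ae mu, forall x, h0 x <= 1}.
  (* Where [h0 > 1] inside [A n], the integral of [h0 - 1] is [phi \1_B - mu B], at most 0 by
     [phi_le]; a positive integrand forces [B] to be null. *)
  have h01 n : {ae mu, forall x, A n x -> h0 x <= 1}.
    pose B := A n `&` [set x | 1 < h0 x].
    have mB : measurable B.
      rewrite /B (_ : [set x | _] = h0 @^-1` `]1, +oo[).
        by apply: measurableI => //; rewrite -[X in measurable X]setTI; exact: mh0.
      by apply/seteqP; split=> x /=; rewrite in_itv/= andbT.
    have Boo : (mu B < +oo)%E by apply: mu_sub_lty (Aoo n) => // x [].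
    have IB := L1_indic mB Boo.
    have IhB : L1 mu (fun x => h0 x * \1_B x).
      apply: L1_le Ih0; first by apply: measurable_funM.
      by move=> x; rewrite indicE; case: (_ \in _); rewrite ?mulr1// mulr0 normr0.
    have : \int[mu]_x `|h0 x * \1_B x - \1_B x| <= 0.
      rewrite (@eq_Rintegral _ _ _ _ _ (fun x => h0 x * \1_B x - \1_B x)); last first.
        move=> x _; rewrite ger0_norm// indicE.
        have [/set_mem[_ /= h]|_] := boolP (x \in B) => /=; lra.
      rewrite RintegralB// h0B// subr_le0.
      exact: phi_le.
    move/(Rintegral_abs_eq0 (L1_sub IhB IB)).
    apply: filterS => x hx Anx; rewrite leNgt; apply/negP => h1.
    have : x \in B by apply: mem_set.
    by move: hx; rewrite indicE => + xB; rewrite xB /= => h0x; move: h1; lra.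
  have := ae_foralln h01; apply: filterS => x hx.
  by have : setT x by []; rewrite AT => -[n _]; exact: hx.
(* Truncation makes the bound hold everywhere, so that [|h * f| <= |f|] at each point. *)
pose h x := Num.min (h0 x) 1.
have hb x : 0 <= h x <= 1 by rewrite /h le_min h00 ler01 ge_min lexx orbT.
have mh : measurable_fun setT h by exact: measurable_minr.
have hh0 : aeeq mu h h0 by apply: filterS h01 => x; rewrite /h; case: leP.
have Ih : L1 mu h.
  apply: L1_le Ih0 => // x; have /andP[? _] := hb x.
  by rewrite !ger0_norm// /h ge_min lexx.
have IhM f : L1 mu f -> L1 mu (fun x => h x * f x).
  move=> If; apply: (L1_le _ _ If).
    by apply: measurable_funM => //; exact: (L1_measurable If).
  move=> x; rewrite normrM; apply: ler_piMl => //.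
  by have /andP[? ?] := hb x; rewrite ger0_norm.
exists h; split => //.
  rewrite L1_integralE// (Rintegral_ae_eq Ih Ih0)//.
  by rewrite -L1_integralE.
have hs s : simple_L1 mu s -> \int[mu]_x (h x * s x) = phi s.
  move: s; apply: simple_L1_ind => [B mB Boo|a f g sf sg hf hg].
    rewrite -h0B//; apply: Rintegral_ae_eq.
    - by apply: IhM; exact: L1_indic.
    - apply: L1_le Ih0; first by apply: measurable_funM.
      by move=> x; rewrite indicE; case: (_ \in _); rewrite ?mulr1// mulr0 normr0.
    - by apply: filterS hh0 => x ->.
  have If := simple_L1_L1 sf; have Ig := simple_L1_L1 sg.
  rewrite phi_lin// -hf -hg -Rintegral_lin; [|exact: IhM..].
  by apply: eq_Rintegral => x _; lra.
move=> f If; apply/eqP; rewrite -subr_eq0 -normr_le0; apply/ler_addgt0Pr => e e0.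
have [s ss fs] := simple_L1_dense If (divr_gt0 e0 (ltr0n _ 2)).
have Is := simple_L1_L1 ss.
have k1 := phi_dist1 If Is.
have k2 : `|\int[mu]_x (h x * f x) - \int[mu]_x (h x * s x)| <= dist1 mu f s.
  apply: le_trans (dist1_integral (IhM _ If) (IhM _ Is)) _.
  apply: le_Rintegral => //; [by apply: L1_dist; exact: IhM|exact: L1_dist|].
  move=> x _; rewrite -mulrBr normrM; apply: ler_piMl => //.
  by have /andP[? ?] := hb x; rewrite ger0_norm.
move: k1 k2; rewrite (hs _ ss) !ler_norml => /andP[? ?] /andP[? ?].
by apply/andP; split; lra.
Qed.

End positive_functional.

(** * Integrals over a set, positivity of the adjoint, and reduction to indicators *)

Section indicator_functional.
Set Implicit Arguments.
Unset Strict Implicit.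
Context (d : measure_display) (X : measurableType d) (R : realType)
        (mu : {measure set X -> \bar R}).
Implicit Types (f : X -> R) (E : set X).

Lemma L1_indicM E f : measurable E -> L1 mu f -> L1 mu (fun x => \1_E x * f x).
Proof.
move=> mE If; apply: (L1_le _ _ If).
  by apply: measurable_funM => //; exact: (L1_measurable If).
by move=> x; rewrite indicE; case: (_ \in _); rewrite ?mul1r// mul0r normr0.
Qed.

Lemma ae_nonneg_indicM E f : ae_nonneg mu f ->
  ae_nonneg mu (fun x => \1_E x * f x).
Proof. by apply: filterS => x fx; rewrite mulr_ge0. Qed.

Lemma Rintegral_indicM_ge0 E f : measurable E -> L1 mu f -> ae_nonneg mu f ->
  0 <= \int[mu]_x (\1_E x * f x).
Proof.
by move=> mE If f0; apply: Rintegral_ae_ge0; [exact: L1_indicM|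
  exact: ae_nonneg_indicM].
Qed.

Lemma Rintegral_indicM_le E f : measurable E -> L1 mu f -> ae_nonneg mu f ->
  \int[mu]_x (\1_E x * f x) <= \int[mu]_x f x.
Proof.
move=> mE If f0; apply: Rintegral_ae_le => //; first exact: L1_indicM.
apply: filterS f0 => x fx.
by rewrite indicE; case: (_ \in _); rewrite ?mul1r// mul0r.
Qed.

(** The adjoint is tested on the indicator of the part [B] of [A n] where [h < 0]: the integral of
    [h] there equals that of [g * Op \1_B], which is nonnegative, so [B] is null. *)
Lemma adjoint_ae_nonneg (A : nat -> set X) Op (g h : X -> R) :
  (forall n, measurable (A n)) -> (forall n, (mu (A n) < +oo)%E) ->
  setT = \bigcup_n A n -> markov_operator mu Op -> (forall x, 0 <= g x <= 1) ->
  measurable_fun setT g -> adjoint_at mu Op g h -> ae_nonneg mu h.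
Proof.
move=> mA Aoo AT /markov_operatorP [OL1 _ O0 _] g01 mg [[mh [M hM]] hE].
suff hn n : {ae mu, forall x, A n x -> 0 <= h x}.
  have := ae_foralln hn; apply: filterS => x hx.
  by have : setT x by []; rewrite AT => -[n _]; exact: hx.
pose B := A n `&` h @^-1` `]-oo, 0[.
have mB : measurable B.
  by apply: measurableI => //; rewrite -[X in measurable X]setTI; exact: mh.
have Boo : (mu B < +oo)%E.
  by apply: le_lt_trans (Aoo n); rewrite le_measure ?mem_set// => x [].
have IB := L1_indic mB Boo.
have IhB : L1 mu (fun x => h x * \1_B x).
  have mhB : measurable_fun setT (fun x => h x * \1_B x) by exact: measurable_funM.
  apply/integrableP; split; first exact/measurable_EFinP.
  (* The majorant has to be nonnegative, and [M] may be negative when [mu] is zero. *)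
  apply: (@le_lt_trans _ _ (\int[mu]_x (`|M| * \1_B x)%:E)%E).
    apply: ae_ge0_le_integral => //=.
    - by apply/measurable_EFinP; exact: measurableT_comp.
    - by apply/measurable_EFinP; exact: measurable_funM.
    - apply: filterS hM => x hx _; rewrite lee_fin normrM [X in _ * X]ger0_norm//.
      by rewrite ler_wpM2r// (le_trans hx)// ler_norm.
  by rewrite L1_integralE ?ltry//; apply: eq_integrable (integrableZl _ `|M| IB).
have : 0 <= \int[mu]_x (h x * \1_B x).
  have := hE _ IB; rewrite /Rintegral => ->.
  apply: Rintegral_ae_ge0.
    apply: L1_le (OL1 _ IB).
      by apply: measurable_funM => //; exact: (L1_measurable (OL1 _ IB)).
    move=> x; rewrite normrM ler_piMl//.
    by have /andP[? ?] := g01 x; rewrite ger0_norm.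
  have := O0 _ IB; case; first exact: aeW.
  move=> N [mN N0 sub]; exists N; split => //; apply: subset_trans sub.
  move=> x /=; apply: contra_not => Ox.
  by have /andP[? ?] := g01 x; rewrite mulr_ge0.
have hB0 x : h x * \1_B x <= 0.
  rewrite indicE; have [/set_mem[_ /=]|_] := boolP (x \in B) => /=; last first.
    by rewrite mulr0.
  by rewrite in_itv/= mulr1 => /ltW.
move=> hB.
have : \int[mu]_x `|h x * \1_B x| <= 0.
  rewrite (@eq_Rintegral _ _ _ _ _ (fun x => -1 * (h x * \1_B x))).
    by rewrite RintegralZl// mulN1r oppr_le0.
  by move=> x _; rewrite ler0_norm// mulN1r.
move/(Rintegral_abs_eq0 IhB); apply: filterS => x hx Anx.
rewrite leNgt; apply/negP => hx0; move: hx.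
have xB : x \in B by apply: mem_set; split => //=; rewrite in_itv.
by rewrite indicE xB mulr1 => hx; rewrite hx ltxx in hx0.
Qed.

Lemma markov_on_simple (S : (X -> R) -> (X -> R)) :
  (forall f, simple_L1 mu f -> L1 mu (S f)) ->
  (forall (a : R) f g, simple_L1 mu f -> simple_L1 mu g ->
     aeeq mu (S (fun x => a * f x + g x)) (fun x => a * S f x + S g x)) ->
  (forall f, simple_L1 mu f -> ae_nonneg mu f -> ae_nonneg mu (S f)) ->
  (forall E, measurable E -> (mu E < +oo)%E ->
    (\int[mu]_x (S (\1_E) x)%:E = mu E)%E) ->
  markov_on mu (simple_L1 mu) S.
Proof.
move=> SL1 Slin S0 SE; split => //.
apply: simple_L1_ind => [B mB Boo|a f g sf sg hf hg].
  by rewrite Rintegral_indic// /Rintegral SE.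
rewrite Rintegral_lin; [|exact: simple_L1_L1..].
rewrite -hf -hg -Rintegral_lin; [|exact: SL1..].
apply: Rintegral_ae_eq.
- by apply: SL1; exact: simple_L1_lin.
- by apply: L1_lin; exact: SL1.
- exact: Slin.
Qed.

End indicator_functional.

(** * Equivalence of unique extendability with positivity and the two integral conditions *)

Theorem theorem3p2 (d : measure_display) (X : measurableType d) (R : realType)
  (mu : {measure set X -> \bar R}) (A : nat -> set X)
  (S : (X -> R) -> (X -> R)) :
  sigma_finite setT mu ->
  (forall n, measurable (A n)) ->
  (forall n, (mu (A n) < +oo)%E) ->
  (forall n, A n `<=` A n.+1) ->
  setT = \bigcup_n A n ->
  (* S : simple functions in L^1 -> L^1 is a well-defined linear map *)
  (forall f, simple_L1 mu f -> L1 mu (S f)) ->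
  (forall f g, simple_L1 mu f -> simple_L1 mu g -> aeeq mu f g ->
     aeeq mu (S f) (S g)) ->
  (forall (a : R) f g, simple_L1 mu f -> simple_L1 mu g ->
     aeeq mu (S (fun x => a * f x + g x)) (fun x => a * S f x + S g x)) ->
  ((exists Op, semi_doubly_stochastic mu Op /\
       (forall f, simple_L1 mu f -> aeeq mu (Op f) (S f))) /\
   (forall Op1 Op2,
       semi_doubly_stochastic mu Op1 ->
       (forall f, simple_L1 mu f -> aeeq mu (Op1 f) (S f)) ->
       semi_doubly_stochastic mu Op2 ->
       (forall f, simple_L1 mu f -> aeeq mu (Op2 f) (S f)) ->
       forall f, L1 mu f -> aeeq mu (Op1 f) (Op2 f)))
  <->
  ((forall f, simple_L1 mu f -> ae_nonneg mu f -> ae_nonneg mu (S f)) /\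
   (forall E, measurable E -> (mu E < +oo)%E ->
      (\int[mu]_x (S (\1_E) x)%:E = mu E)%E /\
      cvgn (fun n => \int[mu]_x ((\1_E x) * S (\1_(A n)) x)%:E)%E /\
      (limn (fun n => \int[mu]_x ((\1_E x) * S (\1_(A n)) x)%:E) <= mu E)%E)).
Proof.
move=> _ mA Aoo AS AT SL1 _ Slin.
have sA n : simple_L1 mu \1_(A n) by exact: simple_L1_indic.
(* Positivity of [S] on [\1_(A n.+1) - \1_(A n)] gives monotonicity. It yields convergence in the
   forward direction and bounds each term by the limit in the backward one. *)
have nd E : measurable E ->
    (forall f, simple_L1 mu f -> ae_nonneg mu f -> ae_nonneg mu (S f)) ->
    nondecreasing_seq (fun n => \int[mu]_x ((\1_E x) * S (\1_(A n)) x)%:E)%E.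
  move=> mE S0; apply/nondecreasing_seqP => n.
  have IS m := L1_indicM mE (SL1 _ (sA m)).
  rewrite !L1_integralE// lee_fin; apply: Rintegral_ae_le => //.
  have h1 := Slin (-1) _ _ (sA n) (sA n.+1).
  have h2 : ae_nonneg mu (S (fun x => -1 * \1_(A n) x + \1_(A n.+1) x)).
    apply: S0; first exact: simple_L1_lin.
    apply: aeW => x; rewrite !indicE.
    have [/set_mem/AS/mem_set ->|_] := boolP (x \in A n) => /=; first by lra.
    by rewrite mulr0 add0r.
  move: h1 h2; apply: filterS2 => x /= -> h; apply: ler_wpM2l => //; lra.
split.
  move=> [[Op [[mOp dOp] OpS]] _]; have mO := mOp.
  move/markov_operatorP : mO => [OL1 Olin O0 OI].
  have S0 f : simple_L1 mu f -> ae_nonneg mu f -> ae_nonneg mu (S f).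
    move=> sf f0; move: (OpS _ sf) (O0 _ (simple_L1_L1 sf) f0).
    by apply: filterS2 => x ->.
  split => // E mE Eoo; split; last split.
  - have sE := simple_L1_indic mE Eoo; have IE := simple_L1_L1 sE.
    rewrite L1_integralE; last exact: SL1.
    rewrite -(Rintegral_ae_eq (OL1 _ IE) (SL1 _ sE) (OpS _ sE)) (OI _ IE).
    by rewrite Rintegral_indic// fineK// ge0_fin_numE.
  - by apply: ereal_nondecreasing_is_cvgn; exact: nd.
  apply: lime_le; first by apply: ereal_nondecreasing_is_cvgn; exact: nd.
  apply: nearW => n.
  have [h [adj hE]] := dOp _ mE Eoo; apply: le_trans hE.
  have h0 : ae_nonneg mu h.
    apply: (adjoint_ae_nonneg mA Aoo AT mOp _ _ adj) => // x.
    by rewrite indicE; case: (_ \in _) => /=; rewrite ?lexx ler01.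
  have [[mh _] hOp] := adj.
  have In := simple_L1_L1 (sA n).
  have -> : (\int[mu]_x (\1_E x * S \1_(A n) x)%:E =
             \int[mu]_x (h x * \1_(A n) x)%:E)%E.
    rewrite hOp//; apply: ae_eq_integral => //.
    - by apply: measurable_int; exact: L1_indicM (SL1 _ (sA n)).
    - by apply: measurable_int; exact: L1_indicM (OL1 _ In).
    - by apply: filterS (OpS _ (sA n)) => x -> _.
  (* [h] is nonnegative only almost everywhere; passing to [|h|] allows a pointwise comparison of
     nonnegative integrands. *)
  have -> : (\int[mu]_x (h x)%:E = \int[mu]_x `|h x|%:E)%E.
    apply: ae_eq_integral => //.
    - exact/measurable_EFinP.
    - by apply/measurable_EFinP; exact: measurableT_comp.
    - by apply: filterS h0 => x /ger0_norm -> _.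
  have -> : (\int[mu]_x (h x * \1_(A n) x)%:E =
             \int[mu]_x (`|h x| * \1_(A n) x)%:E)%E.
    apply: ae_eq_integral => //.
    - by apply/measurable_EFinP; exact: measurable_funM.
    - apply/measurable_EFinP; apply: measurable_funM => //.
      exact: measurableT_comp.
    - by apply: filterS h0 => x /ger0_norm -> _.
  apply: ge0_le_integral => //=.
  - apply/measurable_EFinP; apply: measurable_funM => //.
    exact: measurableT_comp.
  - by apply/measurable_EFinP; exact: measurableT_comp.
  - by move=> x _; rewrite lee_fin ler_piMr// indicE; case: (_ \in _).
move=> [S0 SE].
have mS : markov_on mu (simple_L1 mu) S.
  by apply: markov_on_simple => // E mE Eoo; case: (SE _ mE Eoo).
split; last first.
  move=> Op1 Op2 [/markov_operatorP m1 _] e1 [/markov_operatorP m2 _] e2 f If.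
  exact: (markov_extension_uniq mS m1 e1 m2 e2 If).
have [Op [mO OpS]] := markov_extension_exists mS.
exists Op; split => //; split; first exact/markov_operatorP.
move=> E mE Eoo; have [_ [Ecvg Elim]] := SE _ mE Eoo.
have [OL1 Olin O0 OI] := mO.
have Efin : mu E \is a fin_num by rewrite ge0_fin_numE.
(* The functional integrates [Op f] over [E], with mass bound [mu E]; its density is the adjoint at
   the indicator of [E]. *)
have [|||n|h [mh h01 hE hOp]] := @positive_functional_density _ _ _ mu A
    (fun f => \int[mu]_x (\1_E x * Op f x)) (fine (mu E)) mA Aoo AS AT.
- move=> a f g If Ig.
  have Iaf := L1_indicM mE (OL1 _ If); have Iag := L1_indicM mE (OL1 _ Ig).
  rewrite -Rintegral_lin//; apply: Rintegral_ae_eq.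
  + by apply: L1_indicM => //; apply: OL1; exact: L1_lin.
  + exact: L1_lin.
  + by apply: filterS (Olin a _ _ If Ig) => x ->; lra.
- move=> f If f0; apply: Rintegral_indicM_ge0 => //; first exact: OL1.
  by apply: O0 => //; exact: aeW.
- move=> f If f0; rewrite -(OI _ If); apply: Rintegral_indicM_le => //.
    exact: OL1.
  by apply: O0 => //; exact: aeW.
(* Each term of the nondecreasing sequence is at most its limit, hence at most [mu E]. *)
- have In := simple_L1_L1 (sA n).
  have IO := L1_indicM mE (OL1 _ In); have IS := L1_indicM mE (SL1 _ (sA n)).
  have OS : \int[mu]_x (\1_E x * Op \1_(A n) x) = \int[mu]_x (\1_E x * S \1_(A n) x).
    by apply: Rintegral_ae_eq => //; apply: filterS (OpS _ (sA n)) => x ->.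
  rewrite OS -lee_fin -L1_integralE// fineK//; apply: le_trans Elim; apply: lime_ge => //.
  by exists n => // m /= nm; exact: nd.
exists h; split; last by rewrite fineK in hE.
split.
  split=> //; exists 1; apply: aeW => x.
  by have /andP[? ?] := h01 x; rewrite ger0_norm.
move=> f If; rewrite !L1_integralE ?hOp//; first by apply: L1_indicM => //; exact: OL1.
apply: (L1_le _ _ If); first by apply: measurable_funM => //; exact: (L1_measurable If).
by move=> x; have /andP[? ?] := h01 x; rewrite normrM ler_piMl// ger0_norm.
Qed.
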